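(* The category $\mathbf{BorelStoch}$ does not satisfy the following implication, quantified over all objects $X,Y$, all morphisms $p : I \to X$ and all morphisms $f_1,f_2 : X\otimes X \to Y$: $$(\mathrm{id}_X\otimes f_1)\circ\big((\Delta_X\circ p)\otimes \mathrm{id}_X\big) = (\mathrm{id}_X\otimes f_2)\circ\big((\Delta_X\circ p)\otimes \mathrm{id}_X\big) \;\;\Longrightarrow\;\; f_1\circ\Delta_X\circ p = f_2\circ\Delta_X\circ p,$$ where the two sides of the premise are morphisms $X \to X\otimes Y$ and the two sides of the conclusion are morphisms $I\to Y$. That is, there exist objects $X,Y$ and morphisms $p,f_1,f_2$ of $\mathbf{BorelStoch}$ of these types for which the premise holds and the conclusion fails.
   Context: $\mathbf{BorelStoch}$ is the category whose objects are standard Borel spaces $(X,\Sigma_X)$ and whose morphisms $X\to Y$ are Markov kernels $p : X\times\Sigma_Y\to[0,1]$ (measurable in the first argument, a probability measure in the second); composition is $(gf)(x,E)=\int g(y,E)\,f(x,\mathrm dy)$. It is symmetric monoidal with $\otimes$ the product of spaces on objects and product of measures on kernels, and unit $I$ the one-point space. The copy morphism $\Delta_X : X\to X\otimes X$ is the kernel $x\mapsto\delta_{(x,x)}$. Coherence isomorphisms are suppressed. *)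

(* Defs.v *)
From HB Require Import structures.
From mathcomp Require Import all_boot all_order all_algebra.
From mathcomp Require Import all_classical all_reals all_analysis.
From mathcomp Require Import measurable_realfun.

Set Implicit Arguments.
Unset Strict Implicit.
Unset Printing Implicit Defensive.
Import Order.TTheory GRing.Theory Num.Theory.
Import numFieldNormedType.Exports.

Local Open Scope classical_set_scope.
Local Open Scope ring_scope.
Local Open Scope ereal_scope.

Definition separable_space (T : topologicalType) : Prop :=
  exists2 D : set T, countable D & dense D.

(* Unlike [completeType], this does not require the space to be pointed. *)
Definition complete_space (T : uniformType) : Prop :=
  forall F : set_system T, ProperFilter F -> cauchy F -> exists x : T, F --> x.

(* The Borel sigma-algebra of the metric space is [<<s open>>].  Since [f] is a
   bijection, the last condition says that [f] is an isomorphism of measurable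
   spaces.  A [measurableType] is pointed, so the empty space is left out. *)
Definition standard_borel (R : realType) d (T : measurableType d) : Prop :=
  exists M : metricType R,
    [/\ complete_space M, separable_space M &
      exists2 f : T -> M, bijective f &
        forall A : set M, <<s [set U | open U] >> A <-> measurable (f @^-1` A)].

(* BorelStoch is the full subcategory, on the standard Borel spaces, of the
   category of measurable spaces and Markov kernels.  The structure maps below
   are defined for arbitrary measurable spaces; [R.-pker X ~> Y] is the type of
   Markov kernels. *)

(* A [measure] of the library is a function on all subsets, with unspecified
   values outside the sigma-algebra; equality of kernels X * Sigma_Y -> [0, 1]
   is therefore agreement on the measurable sets, not Leibniz equality. *)
Definition kernel_eq d d' (X : measurableType d) (Y : measurableType d')
    (R : realType) (k l : R.-pker X ~> Y) : Prop :=
  forall (x : X) (E : set Y), measurable E -> k x E = l x E.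

Notation "k =ker l" := (kernel_eq k l) (at level 70, no associativity).

Section composition.
Context d0 d1 d2 (X : measurableType d0) (Y : measurableType d1)
  (Z : measurableType d2) (R : realType).
Variables (g : R.-pker Y ~> Z) (f : R.-pker X ~> Y).

Definition kernel_comp : X -> {measure set Z -> \bar R} := mkcomp_noparam f g.

#[warnings="-redundant-canonical-projection"]
HB.instance Definition _ := SubProbabilityKernel.on kernel_comp.

Let kernel_comp_prob x : kernel_comp x [set: Z] = 1.
Proof.
rewrite /kernel_comp /mkcomp_noparam /= /kcomp_noparam.
under eq_integral do rewrite prob_kernel.
by rewrite integral_cst// mul1e prob_kernel.
Qed.

#[warnings="-redundant-canonical-projection"]
HB.instance Definition _ :=
  isProbabilityKernel.Build _ _ _ _ _ kernel_comp kernel_comp_prob.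

End composition.

Notation "g \ok f" := (kernel_comp g f : _.-pker _ ~> _)
  (at level 50, left associativity).

Lemma kernel_compE d0 d1 d2 (X : measurableType d0) (Y : measurableType d1)
    (Z : measurableType d2) (R : realType) (g : R.-pker Y ~> Z)
    (f : R.-pker X ~> Y) (x : X) (E : set Z) :
  (g \ok f) x E = \int[f x]_y g y E.
Proof. by []. Qed.

(* The library gives [k x] only the type of a measure; this alias also carries the
   probability (hence sigma-finite) structure that the product [\x] requires. *)
Section kernel_at.
Context d d' (X : measurableType d) (Y : measurableType d') (R : realType).
Variables (k : R.-pker X ~> Y) (x : X).

Definition kernel_at : set Y -> \bar R := k x.

HB.instance Definition _ := Measure.on kernel_at.

Let kernel_at_prob : kernel_at [set: Y] = 1.
Proof. exact: prob_kernel. Qed.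

HB.instance Definition _ :=
  Measure_isProbability.Build _ _ _ kernel_at kernel_at_prob.

End kernel_at.

Section tensor.
Context d0 d0' d1 d1' (X : measurableType d0) (X' : measurableType d0')
  (Y : measurableType d1) (Y' : measurableType d1') (R : realType).
Variables (f : R.-pker X ~> Y) (g : R.-pker X' ~> Y').

Definition kernel_tensor (x : X * X') : {measure set (Y * Y') -> \bar R} :=
  kernel_at f x.1 \x kernel_at g x.2.

Let mfst : measurable_fun [set: X * X'] fst.
Proof. exact: measurable_fst. Qed.

Let msnd : measurable_fun [set: (X * X') * Y] (snd \o fst : _ -> X').
Proof. exact: measurableT_comp measurable_snd measurable_fst. Qed.

Let f1 : X * X' -> {measure set Y -> \bar R} := f \o fst.

Let f1_measurable U : measurable U -> measurable_fun [set: X * X'] (f1 ^~ U).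
Proof.
move=> mU; have -> : f1 ^~ U = (f ^~ U) \o fst by [].
exact: measurableT_comp (measurable_kernel f U mU) mfst.
Qed.

HB.instance Definition _ := isKernel.Build _ _ _ _ _ f1 f1_measurable.

Let f1_prob x : f1 x setT = 1.
Proof. exact: prob_kernel. Qed.

HB.instance Definition _ := Kernel_isProbability.Build _ _ _ _ _ f1 f1_prob.

Let g2 : (X * X') * Y -> {measure set Y' -> \bar R} := g \o (snd \o fst).

Let g2_measurable U :
  measurable U -> measurable_fun [set: (X * X') * Y] (g2 ^~ U).
Proof.
move=> mU; have -> : g2 ^~ U = (g ^~ U) \o (snd \o fst) by [].
exact: measurableT_comp (measurable_kernel g U mU) msnd.
Qed.

HB.instance Definition _ := isKernel.Build _ _ _ _ _ g2 g2_measurable.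

Let g2_prob x : g2 x setT = 1.
Proof. exact: prob_kernel. Qed.

HB.instance Definition _ := Kernel_isProbability.Build _ _ _ _ _ g2 g2_prob.

Let kernel_tensor_measurable U : measurable U ->
  measurable_fun [set: X * X'] (kernel_tensor ^~ U).
Proof.
move=> mU.
pose h : ((X * X') * Y) * Y' -> Y * Y' := fun z => (z.1.2, z.2).
have mh : measurable_fun setT h.
  apply/measurable_fun_pair => /=; last exact: measurable_snd.
  exact: measurableT_comp measurable_snd measurable_fst.
have mhU : measurable (h @^-1` U) by rewrite -[X in measurable X]setTI; exact: mh.
have mg : measurable_fun setT
    (fun z : (X * X') * Y => g2 z (xsection (h @^-1` U) z)).
  by apply: measurable_fun_xsection_finite_kernel; rewrite inE.
have := @measurable_fun_integral_finite_kernel _ _ _ _ _ _ f1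
  (fun z => measure_ge0 _ _) mg.
apply: eq_measurable_fun => x _.
rewrite /kernel_tensor /= /product_measure1; apply: eq_integral => y _ /=.
by congr (g _ _); apply/seteqP; split => z; rewrite /xsection/= !inE.
Qed.

HB.instance Definition _ :=
  isKernel.Build _ _ _ _ _ kernel_tensor kernel_tensor_measurable.

Let kernel_tensor_prob x : kernel_tensor x [set: Y * Y'] = 1.
Proof.
by rewrite -setXTT /kernel_tensor/= product_measure1E//= !prob_kernel mule1.
Qed.

HB.instance Definition _ :=
  Kernel_isProbability.Build _ _ _ _ _ kernel_tensor kernel_tensor_prob.

End tensor.

Notation "f \ox g" := (kernel_tensor f g : _.-pker _ ~> _)
  (at level 45, left associativity).

Section structure_maps.
Context (R : realType).

Definition kernel_id d (X : measurableType d) : R.-pker X ~> X :=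
  kdirac (@measurable_id _ X setT).

Section copy.
Context d (X : measurableType d).

Let copy (x : X) := (x, x).

Let measurable_copy : measurable_fun [set: X] copy.
Proof. by apply/measurable_fun_pair; exact: measurable_id. Qed.

Definition kernel_copy : R.-pker X ~> (X * X)%type := kdirac measurable_copy.

End copy.

(* X -> I (x) X, with I = unit carrying its discrete sigma-algebra *)
Section unitor.
Context d (X : measurableType d).

Let unitl (x : X) := (tt, x).

Let measurable_unitl : measurable_fun [set: X] unitl.
Proof. by apply/measurable_fun_pair => //; exact: measurable_cst. Qed.

Definition kernel_unitl_inv : R.-pker X ~> (unit * X)%type :=
  kdirac measurable_unitl.

End unitor.

Section associator.
Context d0 d1 d2 (X : measurableType d0) (Y : measurableType d1)
  (Z : measurableType d2).

Let assoc (t : (X * Y) * Z) := (t.1.1, (t.1.2, t.2)).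

Let measurable_assoc : measurable_fun [set: (X * Y) * Z] assoc.
Proof.
apply/measurable_fun_pair => /=.
  exact: measurableT_comp measurable_fst measurable_fst.
apply/measurable_fun_pair => /=; last exact: measurable_snd.
exact: measurableT_comp measurable_snd measurable_fst.
Qed.

Definition kernel_assoc : R.-pker ((X * Y) * Z) ~> (X * (Y * Z))%type :=
  kdirac measurable_assoc.

End associator.

End structure_maps.

Arguments kernel_id {R d} X.
Arguments kernel_copy {R d} X.
Arguments kernel_unitl_inv {R d} X.
Arguments kernel_assoc {R d0 d1 d2} X Y Z.

(* (id_X (x) f) o ((Delta_X o p) (x) id_X) : X -> X (x) Y, with the coherence
   isomorphisms X -> I (x) X and (X (x) X) (x) X -> X (x) (X (x) X) inserted *)
Definition copy_then_apply (R : realType) dX dY (X : measurableType dX)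
    (Y : measurableType dY) (p : R.-pker unit ~> X) (f : R.-pker (X * X) ~> Y) :
    R.-pker X ~> (X * Y)%type :=
  (kernel_id X \ox f) \ok kernel_assoc X X X
    \ok ((kernel_copy X \ok p) \ox kernel_id X) \ok kernel_unitl_inv X.

(* Main.v *)
Require Import Defs.
From HB Require Import structures.
From mathcomp Require Import all_boot all_order all_algebra.
From mathcomp Require Import all_classical all_reals all_analysis.
From mathcomp Require Import measurable_realfun.

Local Open Scope classical_set_scope.
Local Open Scope ring_scope.
Local Open Scope ereal_scope.

Import Order.TTheory GRing.Theory Num.Theory.
Import numFieldNormedType.Exports.

(** The implication fails as soon as [X] carries an atomless probability [p]: take
[f1 (x, y)] to be the point mass at [1] or [0] according to whether [x = y], and
[f2] the constant point mass at [0].  For a fixed input [y], the copied sample [x]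
differs from [y] almost surely, so the premise holds; feeding both copies of the
same sample to [f1] and [f2] tells them apart. *)

Lemma standard_borel_real (R : realType) : standard_borel R (measurableTypeR R).
Proof.
exists R^o; split.
- by move=> F FF Fc; exists (lim F); exact: cauchy_cvg.
- by exists (range (@ratr R)); [apply: card_le_trans (card_image_le _ _) _; exact: countableP | exact: dense_rat].
- exists id; first by exists id.
  move=> A; rewrite preimage_id; split.
    apply: smallest_sub; first exact: sigma_algebra_measurable.
    exact: open_measurable.
  (* For the converse inclusion, take the open intervals as generators of the measurable sets: each
     of them is open. *)
  have -> : @measurable _ (measurableTypeR R) = <<s @RGenOpens.G R >>.
    exact: RGenOpens.measurableE.
  apply: sub_smallest2r; first exact: smallest_sigma_algebra.
  by move=> _ [x [y ->]]; exact: interval_open.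
Qed.

Lemma kernel_comp_kdirac (R : realType) d0 d1 d2 (X : measurableType d0)
    (Y : measurableType d1) (Z : measurableType d2) (g : R.-pker Y ~> Z)
    (f : X -> Y) (mf : measurable_fun setT f) (x : X) (E : set Z) :
  measurable E -> (g \ok kdirac mf) x E = g (f x) E.
Proof.
move=> mE; rewrite kernel_compE integral_dirac//.
- by rewrite diracT mul1e.
- exact: measurable_kernel.
Qed.

Lemma kernel_comp_copyE (R : realType) d d' (X : measurableType d)
    (Y : measurableType d') (p : R.-pker unit ~> X) (f : R.-pker (X * X) ~> Y)
    (u : unit) (E : set Y) : measurable E ->
  (f \ok kernel_copy X \ok p) u E = \int[p u]_x f (x, x) E.
Proof.
move=> mE; rewrite kernel_compE; apply: eq_integral => x _.
exact: kernel_comp_kdirac.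
Qed.

(** One copy of the sample stays independent of the fixed input [u.2]: the last two coordinates of
    [z] have law [p] times the point mass at [u.2], so only the slice of [N] at [u.2] counts. *)
Lemma copy_tensor_id_null (R : realType) d (X : measurableType d)
    (p : R.-pker unit ~> X) (N : set (X * X)) (u : unit * X) : measurable N ->
  p u.1 [set a | N (a, u.2)] = 0 ->
  ((kernel_copy X \ok p) \ox kernel_id X) u [set z | N (z.1.2, z.2)] = 0.
Proof.
move=> mN pN0; rewrite /= /kernel_tensor /= /product_measure1.
have mNu : measurable [set a | N (a, u.2)].
  by rewrite (_ : [set a | _] = ysection N u.2);
    [exact: measurable_ysection | rewrite ysectionE].
have mNu2 : measurable [set ab : X * X | N (ab.2, u.2)].
  by have := @measurable_snd _ _ X X measurableT _ mNu; rewrite setTI.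
(* The identity factor is a point mass at [u.2], so the measure of each section is the value of an
   indicator. *)
transitivity (\int[kernel_at (kernel_copy X \ok p) u.1]_ab
    (\1_[set ab : X * X | N (ab.2, u.2)] ab)%:E).
  apply: eq_integral => ab _; rewrite /= /kernel_at /= diracE indicE mem_xsection.
  by congr (_%:R%:E); congr nat_of_bool; apply/idP/idP => /set_mem ?;
    exact/mem_set.
rewrite integral_indic// setIT.
rewrite -[LHS]/((kernel_copy X \ok p) u.1 _) kernel_compE.
transitivity (\int[p u.1]_a (\1_[set a | N (a, u.2)] a)%:E).
  apply: eq_integral => a _; rewrite /= diracE indicE.
  by congr (_%:R%:E); congr nat_of_bool; apply/idP/idP => /set_mem ?;
    exact/mem_set.
by rewrite integral_indic// setIT.
Qed.

(** Both sides integrate against the law of [((a, a), x)] with [a] drawn from [p]. The integrands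
    can differ only where [(a, x)] lies in [N], which is a null event for every input [x]. *)
Lemma copy_then_apply_ae_eq (R : realType) dX dY (X : measurableType dX)
    (Y : measurableType dY) (p : R.-pker unit ~> X)
    (f g : R.-pker (X * X) ~> Y) (N : set (X * X)) : measurable N ->
    (forall x, p tt [set a | N (a, x)] = 0) ->
    (forall z, ~ N z -> forall E, measurable E -> f z E = g z E) ->
  copy_then_apply p f =ker copy_then_apply p g.
Proof.
move=> mN pN0 fg x E mE; rewrite /copy_then_apply !kernel_compE.
apply: eq_integral => -[[] y] _; rewrite !kernel_compE.
apply: ge0_ae_eq_integral => //.
- exact: measurable_kernel.
- exact: measurable_kernel.
(* After reassociation, [f] and [g] receive the pair [(z.1.2, z.2)]. *)
exists [set z | N (z.1.2, z.2)]; split.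
- pose h (z : (X * X) * X) := (z.1.2, z.2).
  have mh : measurable_fun setT h.
    apply/measurable_fun_pair => /=; last exact: measurable_snd.
    exact: measurableT_comp measurable_snd measurable_fst.
  by rewrite -[X in measurable X]setTI; exact: mh.
- exact: copy_tensor_id_null.
- move=> z; apply: contra_notP => Nz _.
  rewrite !kernel_comp_kdirac//.
  (* The product measure integrates the values of [f] or [g] on the sections of [E], where they
     agree off [N]. *)
  rewrite /kernel_tensor /= /product_measure1; apply: eq_integral => a _ /=.
  by apply: fg => //; exact: measurable_xsection.
Qed.

Theorem mainTheorem1 (R : realType) :
  exists (dX dY : measure_display)
    (X : measurableType dX) (Y : measurableType dY),
    [/\ standard_borel R X, standard_borel R Y &
      exists (p : R.-pker unit ~> X) (f1 f2 : R.-pker (X * X) ~> Y),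
        copy_then_apply p f1 =ker copy_then_apply p f2 /\
        ~ (f1 \ok kernel_copy X \ok p =ker f2 \ok kernel_copy X \ok p)].
Proof.
pose X := measurableTypeR R.
exists _, _, X, X; split; [exact: standard_borel_real..|].
pose D : set (X * X) := [set z | z.1 = z.2].
have mD : measurable D.
  rewrite (_ : D = (fun z : X * X => z.1 - z.2)%R @^-1` [set 0%R]).
    rewrite -[X in measurable X]setTI.
    by apply: (@measurable_funB _ _ R setT (fst : X * X -> R) (snd : X * X -> R));
      [exact: measurable_fst | exact: measurable_snd | | exact: measurable_set1].
  by apply/seteqP; split => -[x y]/=; rewrite /D/= => /eqP;
    [rewrite -subr_eq0 => /eqP | rewrite subr_eq0 => /eqP].
pose p : R.-pker unit ~> X := kprobability
  (measurable_cst (uniform_prob (@ltr01 R) : pprobability X R)).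
have pE : p tt = uniform_prob (@ltr01 R) :> (set X -> \bar R) by [].
have mindic : measurable_fun setT (\1_D : X * X -> X) by exact: measurable_indic.
pose f1 : R.-pker (X * X) ~> X := kdirac mindic.
pose f2 : R.-pker (X * X) ~> X := kdirac (measurable_cst (0%R : X)).
exists p, f1, f2; split.
  apply: (@copy_then_apply_ae_eq _ _ _ _ _ _ _ _ D) => //.
  (* A slice of the diagonal is a singleton, hence Lebesgue null, and the uniform law on the unit
     interval is absolutely continuous. *)
  - move=> x; rewrite pE (_ : [set a | D (a, x)] = [set x])//.
    have /null_content_dominatesP := dominates_uniform_prob (@ltr01 R).
    apply => //; exact: lebesgue_measure_set1.
  - by move=> z Dz E mE; rewrite /f1 /f2 /= indicE memNset.
(* The event [[set 1]] separates the two sides: on the diagonal [f1] gives it mass 1 and [f2] mass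
   0, so equality would force 1 = 0. *)
move=> /(_ tt [set 1%R] (measurable_set1 _)).
rewrite !kernel_comp_copyE; [|exact: measurable_set1..].
under eq_integral => x _.
  rewrite /f1 /= indicE mem_set// diracE mem_set//.
  over.
under [in RHS]eq_integral => x _.
  rewrite /f2 /= diracE memNset; last by move=> /= /eqP; rewrite eq_sym oner_eq0.
  over.
rewrite integral0 integral_cst// prob_kernel mul1e => /eqP.
by rewrite eqe oner_eq0.
Qed.
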